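(* For every integer $n \geq 1$, the set-graph $G_{A^{(n)}}$ satisfies $r^-_\chi(G_{A^{(n)}}) = r^+_\chi(G_{A^{(n)}}) = 2^n - 1$.
   Context: Set-graph: let $A^{(n)} = \{a_1, a_2, \dots, a_n\}$, $n \in \mathbb{N}$, be a set with $n$ elements. The set-graph $G_{A^{(n)}}$ is the simple graph whose vertices are the non-empty subsets of $A^{(n)}$, two distinct vertices being adjacent if and only if the corresponding subsets have non-empty intersection. Colourings: a proper vertex colouring of a graph $G$ using exactly $\chi(G)$ colours $c_1, \dots, c_{\chi(G)}$, where $\chi(G)$ is the chromatic number, is called a chromatic colouring (or minimum proper colouring) of $G$. The colour class of $c_i$ is denoted $\mathcal{C}_i$. The rainbow neighbourhood convention is that $\mathcal{C}_1$ is a maximal independent set of $G$, $\mathcal{C}_2$ is a maximal independent set of $G - \mathcal{C}_1$, and so on until all vertices are coloured. The permissible colour allocations are the chromatic colourings of $G$ that follow this convention. Rainbow neighbourhoods: given a chromatic colouring of $G$, a vertex $v$ yields a rainbow neighbourhood if its closed neighbourhood $N[v]$ contains at least one vertex of each of the $\chi(G)$ colours. The rainbow neighbourhood number $r_\chi(G)$ is the number of vertices of $G$ that yield rainbow neighbourhoods. $r^-_\chi(G)$ and $r^+_\chi(G)$ denote respectively the minimum and the maximum value of $r_\chi(G)$ over all permissible colour allocations. *)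

(* Defs.v *)
From mathcomp Require Import all_boot.

Set Implicit Arguments.
Unset Strict Implicit.
Unset Printing Implicit Defensive.

Record sgraph := SGraph {
  vertex :> finType;
  adj : rel vertex;
  adj_sym : symmetric adj;
  adj_irr : irreflexive adj
}.

Section Colourings.

Variable G : sgraph.

Definition closed_nbhd (v : G) : {set G} := [set u | (u == v) || adj v u].

Definition independent (S : {set G}) : bool :=
  [forall u in S, forall v in S, ~~ adj u v].

Definition proper_colouring k (c : {ffun G -> 'I_k}) : bool :=
  [forall u, forall v, adj u v ==> (c u != c v)].

Definition colourable k : bool :=
  [exists c : {ffun G -> 'I_k}, proper_colouring c].

Lemma ex_colourable : exists k, colourable k.
Proof.
exists #|G|; apply/existsP; exists [ffun v => enum_rank v].
apply/forallP=> u; apply/forallP=> v; apply/implyP=> uv.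
rewrite !ffunE (inj_eq enum_rank_inj).
by apply: contraTneq uv => ->; rewrite adj_irr.
Qed.

Definition chromatic_number : nat := ex_minn ex_colourable.

(* The colours c_1, ..., c_k are numbered from 0. *)
Definition colour_class k (c : {ffun G -> 'I_k}) (i : 'I_k) : {set G} :=
  [set v | c v == i].

Definition chromatic_colouring (c : {ffun G -> 'I_chromatic_number}) : bool :=
  proper_colouring c && [forall i, exists v, c v == i].

(* Vertices of the graph obtained by deleting all classes before the i-th. *)
Definition remaining k (c : {ffun G -> 'I_k}) (i : 'I_k) : {set G} :=
  ~: \bigcup_(j : 'I_k | j < i) colour_class c j.

(* Maximality is with respect to inclusion. The independent sets of an induced
   subgraph are the independent sets of G contained in its vertex set. *)
Definition rainbow_convention k (c : {ffun G -> 'I_k}) : bool :=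
  [forall i, maxset (fun S => (S \subset remaining c i) && independent S)
                    (colour_class c i)].

Definition permissible (c : {ffun G -> 'I_chromatic_number}) : bool :=
  chromatic_colouring c && rainbow_convention c.

Definition yields_rainbow k (c : {ffun G -> 'I_k}) (v : G) : bool :=
  [forall i, exists u in closed_nbhd v, c u == i].

Definition rainbow_number k (c : {ffun G -> 'I_k}) : nat :=
  #|[set v | yields_rainbow c v]|.

(* The minimum and the maximum are required to be attained, so neither
   predicate holds if there is no permissible colouring. *)
Definition is_min_rainbow_number (m : nat) : Prop :=
  (exists2 c, permissible c & rainbow_number c = m) /\
  (forall c, permissible c -> m <= rainbow_number c).

Definition is_max_rainbow_number (m : nat) : Prop :=
  (exists2 c, permissible c & rainbow_number c = m) /\
  (forall c, permissible c -> rainbow_number c <= m).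

End Colourings.

Section SetGraph.

Variable A : finType.

Definition nonempty_set := {B : {set A} | B != set0}.

Definition meets (B C : nonempty_set) : bool :=
  (B != C) && (val B :&: val C != set0).

Lemma meets_sym : symmetric meets.
Proof. by move=> B C; rewrite /meets eq_sym setIC. Qed.

Lemma meets_irr : irreflexive meets.
Proof. by move=> B; rewrite /meets eqxx. Qed.

Definition set_graph : sgraph := SGraph meets_sym meets_irr.

End SetGraph.

(* Main.v *)
Require Import Defs.
From mathcomp Require Import all_boot.

(** Fix an element [a] of the ground set.  The subsets containing [a] pairwise
    meet, so they form a clique, the star of [a].  Every non-empty subset [B]
    contains [a] or has a complement that does; sending [B] to whichever of
    [B] and its complement contains [a] therefore retracts the graph onto the
    star, and two sets with the same image are equal or complementary, hence
    non-adjacent.  So the retraction is a proper colouring with as many colours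
    as the star has vertices, and the chromatic number is the size of the star
    of any element.

    This has two consequences.  First, in every chromatic colouring each star
    carries all the colours, exactly once each.  A vertex [B] has some element
    [a], and the whole star of [a] lies in the closed neighbourhood of [B];
    hence every vertex yields a rainbow neighbourhood
    ([rainbow_number_clique_nbhd]) and the rainbow number is always the number
    of vertices, 2 ^ n - 1.  Second, permissible colourings exist: each class
    [{B, ~: B}] of the retraction is a maximal independent set of the whole
    graph, because a set disjoint from both [B] and its complement is empty;
    such classes obey the rainbow convention in whatever order they are numbered
    ([star_colouring]). *)

Set Implicit Arguments.
Unset Strict Implicit.
Unset Printing Implicit Defensive.

Section Cliques.

Variable G : sgraph.

Definition clique (Q : {set G}) : Prop := {in Q &, forall u v, u != v -> adj u v}.

Lemma proper_colouringP k (c : {ffun G -> 'I_k}) :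
  reflect (forall u v, adj u v -> c u != c v) (proper_colouring c).
Proof.
apply: (iffP forallP) => [cP u v | cP u].
  by move/forallP: (cP u) => /(_ v) /implyP.
by apply/forallP => v; apply/implyP; apply: cP.
Qed.

Lemma independentP (S : {set G}) :
  reflect {in S &, forall u v, ~~ adj u v} (independent S).
Proof.
apply: (iffP forall_inP) => [indS u v uS | indS u uS].
  by move/forall_inP: (indS u uS); apply.
by apply/forall_inP => v vS; apply: indS.
Qed.

Lemma chromatic_number_min k : colourable G k -> chromatic_number G <= k.
Proof. by rewrite /chromatic_number; case: ex_minnP => m _; apply. Qed.

Lemma chromatic_number_colourable : colourable G (chromatic_number G).
Proof. by rewrite /chromatic_number; case: ex_minnP. Qed.

Lemma proper_clique_inj k (c : {ffun G -> 'I_k}) (Q : {set G}) :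
  proper_colouring c -> clique Q -> {in Q &, injective c}.
Proof.
move=> /proper_colouringP cP Qcl u v uQ vQ cuv; apply/eqP.
by apply: contraT => /(Qcl u v uQ vQ) /cP; rewrite cuv eqxx.
Qed.

Lemma leq_clique_colours k (c : {ffun G -> 'I_k}) (Q : {set G}) :
  proper_colouring c -> clique Q -> #|Q| <= k.
Proof.
move=> cP Qcl; rewrite -(card_in_imset (proper_clique_inj cP Qcl)).
by rewrite -[leqRHS]card_ord max_card.
Qed.

Lemma clique_all_colours k (c : {ffun G -> 'I_k}) (Q : {set G}) (i : 'I_k) :
  proper_colouring c -> clique Q -> #|Q| = k ->
  exists2 u, u \in Q & c u = i.
Proof.
move=> cP Qcl Qk.
have cQT : c @: Q = setT.
  apply/eqP; rewrite eqEcard subsetT /= cardsT card_ord.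
  by rewrite (card_in_imset (proper_clique_inj cP Qcl)) Qk.
by have: i \in c @: Q by [rewrite cQT inE]; case/imsetP => u uQ ->; exists u.
Qed.

(** A clique with as many vertices as there are colours sees each of them, so it
    makes any closed neighbourhood containing it a rainbow one. *)
Lemma rainbow_number_clique_nbhd k (c : {ffun G -> 'I_k}) :
  proper_colouring c ->
  (forall v : G, exists Q : {set G},
     [/\ clique Q, #|Q| = k & Q \subset closed_nbhd v]) ->
  rainbow_number c = #|G|.
Proof.
move=> cP nbhdQ; rewrite /rainbow_number -cardsT; congr #|pred_of_set _|.
apply/setP=> v; rewrite !inE; apply/forallP => i.
have [Q [Qcl Qk /subsetP Qv]] := nbhdQ v.
have [u uQ cu] := clique_all_colours i cP Qcl Qk.
by apply/exists_inP; exists u; [apply: Qv | apply/eqP].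
Qed.

(** Deleting vertices of the other classes leaves a class maximal independent,
    so the order of the colours does not matter here. *)
Lemma maximal_classes_convention k (c : {ffun G -> 'I_k}) :
  (forall i, maxset (@independent G) (colour_class c i)) ->
  rainbow_convention c.
Proof.
move=> maxc; apply/forallP => i.
have [indi maxi] := maxsetP (maxc i).
apply/maxsetP; split=> [|S /andP[_ indS]]; last exact: maxi.
rewrite indi andbT; apply/subsetP => v; rewrite !inE => /eqP cvi.
by apply/bigcupP => -[j ltji]; rewrite inE cvi => /eqP eij; rewrite eij ltnn in ltji.
Qed.

End Cliques.

Section Stars.

Variable A : finType.

Implicit Types (B C : set_graph A) (a : A).

Definition star a : {set set_graph A} := [set B : set_graph A | a \in val B].

Lemma card_set_graph : #|set_graph A| = 2 ^ #|A| - 1.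
Proof.
rewrite card_sig -cardsT -card_powerset powersetT subn1.
by rewrite (cardsD1 set0 setT) inE /=; apply: eq_card => B; rewrite !inE andbT.
Qed.

Lemma star_clique a : clique (star a).
Proof.
move=> B C; rewrite !inE => aB aC neBC; rewrite /= /meets neBC.
by apply/set0Pn; exists a; rewrite inE aB.
Qed.

Lemma star_closed_nbhd a B : a \in val B -> star a \subset closed_nbhd B.
Proof.
move=> aB; apply/subsetP => C aC; rewrite inE.
have [//| neCB] := eqVneq C B; apply/orP; right.
by apply: (@star_clique a); rewrite // ?inE // eq_sym.
Qed.

(* The default value [B] is never reached: if [a] is not in [B], then it is in
   the complement of [B], which is therefore non-empty. *)
Definition star_retract a B : set_graph A :=
  if a \in val B then B else insubd B (~: val B).

Lemma val_star_retract a B :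
  val (star_retract a B) = if a \in val B then val B else ~: val B.
Proof.
rewrite /star_retract; case: ifPn => // aB; rewrite val_insubd ifT //.
by apply/set0Pn; exists a; rewrite inE.
Qed.

Lemma star_retract_in a B : star_retract a B \in star a.
Proof. by rewrite inE val_star_retract; case: ifPn => // aB; rewrite inE. Qed.

Lemma star_retract_id a B : B \in star a -> star_retract a B = B.
Proof. by rewrite inE /star_retract => ->. Qed.

Lemma star_retract_proper a B C :
  adj B C -> star_retract a B != star_retract a C.
Proof.
case/andP=> neBC; apply: contraNneq => /(congr1 val).
rewrite !val_star_retract; case: ifP => _; case: ifP => _ eBC.
- by rewrite (val_inj eBC) eqxx in neBC.
- by rewrite eBC setIC setICr.
- by rewrite -eBC setICr.
- by rewrite (val_inj (setC_inj eBC)) eqxx in neBC.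
Qed.

(** A set other than [U] that is disjoint from [U] lies in the complement of
    [U], hence meets it; the complement retracts to [U], so independence forces
    the set to be that complement. *)
Lemma star_fibre_maximal a (U : set_graph A) (S : {set set_graph A}) :
  U \in star a -> independent S -> [set B | star_retract a B == U] \subset S ->
  S \subset [set B | star_retract a B == U].
Proof.
move=> aU /independentP indS /subsetP fibS; apply/subsetP => X XS.
have US : U \in S by apply: fibS; rewrite inE star_retract_id.
rewrite inE; have [-> | neXU] := eqVneq X U; first by rewrite star_retract_id.
have := indS _ _ XS US; rewrite /= /meets neXU negbK /= => /eqP XU0.
have sXU : val X \subset ~: val U by rewrite -disjoints_subset -setI_eq0 XU0.
have [x xX] := set0Pn _ (valP X).
have U'0 : ~: val U != set0 by apply/set0Pn; exists x; apply: (subsetP sXU).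
pose U' : set_graph A := Sub (~: val U) U'0.
have rU' : star_retract a U' = U.
  apply/val_inj; rewrite val_star_retract SubK inE.
  by move: aU; rewrite inE => ->; rewrite setCK.
have U'S : U' \in S by apply: fibS; rewrite inE rU'.
have [-> | neXU'] := eqVneq X U'; first by rewrite rU'.
have := indS _ _ XS U'S; rewrite /= /meets neXU' SubK (setIidPl sXU).
by rewrite (valP X).
Qed.

(** Numbering the star turns the retraction into a colouring.  The number of
    colours is a variable so that it can be instantiated by the chromatic
    number, which is only propositionally equal to the size of the star. *)
Lemma star_colouring a k : #|star a| = k ->
  exists c : {ffun set_graph A -> 'I_k},
    [/\ proper_colouring c, forall i, exists B, c B = i & rainbow_convention c].
Proof.
move=> <-{k}; have [U0 aU0] : exists U0, U0 \in star a.
  have a0 : [set a] != set0 by apply/set0Pn; exists a; rewrite inE.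
  by exists (Sub [set a] a0); rewrite inE SubK inE.
pose c : {ffun set_graph A -> 'I_#|star a|} :=
  [ffun B => enum_rank_in aU0 (star_retract a B)].
have cP : proper_colouring c.
  apply/proper_colouringP => B C /(star_retract_proper a); apply: contraNneq.
  rewrite !ffunE => eBC; apply/eqP.
  exact: enum_rank_in_inj (star_retract_in a B) (star_retract_in a C) eBC.
have cE i : colour_class c i = [set B | star_retract a B == enum_val i].
  apply/setP => B; rewrite !inE ffunE; apply/eqP/eqP => [<- | ->].
    by rewrite enum_rankK_in // star_retract_in.
  by rewrite enum_valK_in.
exists c; split=> // [i|].
  exists (enum_val i); rewrite ffunE star_retract_id ?enum_valK_in //.
  exact: enum_valP.
apply: maximal_classes_convention => i; apply/maxsetP; split.
  apply/independentP => B C; rewrite !inE => /eqP cB /eqP cC.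
  by apply/negP => /(proper_colouringP c cP); rewrite cB cC eqxx.
move=> S indS; rewrite cE => sub; apply/eqP; rewrite eqEsubset sub andbT.
by apply: star_fibre_maximal => //; apply: enum_valP.
Qed.

Lemma chromatic_number_set_graph a : #|star a| = chromatic_number (set_graph A).
Proof.
apply/eqP; rewrite eqn_leq; apply/andP; split.
  have /existsP[c cP] := chromatic_number_colourable (set_graph A).
  exact: leq_clique_colours cP (@star_clique a).
apply: chromatic_number_min.
have [c [cP _ _]] := star_colouring (erefl #|star a|).
by apply/existsP; exists c.
Qed.

Lemma rainbow_number_set_graph
    (c : {ffun set_graph A -> 'I_(chromatic_number (set_graph A))}) :
  proper_colouring c -> rainbow_number c = 2 ^ #|A| - 1.
Proof.
move=> cP; rewrite -card_set_graph; apply: rainbow_number_clique_nbhd => // B.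
have [a aB] := set0Pn _ (valP B); exists (star a); split.
- exact: star_clique.
- exact: chromatic_number_set_graph.
- exact: star_closed_nbhd.
Qed.

Lemma set_graph_permissible a :
  exists c : {ffun set_graph A -> 'I_(chromatic_number (set_graph A))},
    permissible c.
Proof.
have [c [cP c_onto cconv]] := star_colouring (chromatic_number_set_graph a).
exists c; rewrite /permissible /chromatic_colouring cP cconv andbT.
by apply/forallP => i; have [B cB] := c_onto i; apply/existsP; exists B; apply/eqP.
Qed.

End Stars.

Theorem theorem2p7 (n : nat) (hn : 1 <= n) (A : finType) (hA : #|A| = n) :
  is_min_rainbow_number (set_graph A) (2 ^ n - 1) /\
  is_max_rainbow_number (set_graph A) (2 ^ n - 1).
Proof.
have rainbowE c : @permissible (set_graph A) c -> rainbow_number c = 2 ^ n - 1.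
  by case/andP => /andP[cP _] _; rewrite rainbow_number_set_graph // hA.
have /card_gt0P[a _] : 0 < #|A| by rewrite hA.
have [c0 c0P] := set_graph_permissible a.
by split; split=> [|c cP]; rewrite ?rainbowE //; exists c0; rewrite ?rainbowE.
Qed.
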